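(* Let $Q$ be a quandle, let $f\in Aut(Q)$, and let $X_f$ be the biquandle with $\mathcal{Q}(X_f)=Q$ that is given by the constant biquandle structure $\{\beta_y=f\mid y\in Q\}$. Then $Aut(X_f)\cong C_{Aut(Q)}(f)$, the centralizer of $f$ in $Aut(Q)$.
   Context: A quandle is a set $Q$ with a binary operation $*$ such that (1) $x*x=x$ for all $x$; (2) for every $y$ the map $S_y(x)=x*y$ is a bijection of $Q$; (3) $(x*y)*z=(x*z)*(y*z)$ for all $x,y,z$. $Aut(Q)$ is the group of bijective quandle homomorphisms $Q\to Q$. A biquandle is a set $B$ with two binary operations $\underline{\ast},\overline{\ast}$ such that (1) $x\,\underline{\ast}\,x=x\,\overline{\ast}\,x$ for all $x$; (2) the maps $\alpha_y(x)=x\,\underline{\ast}\,y$ and $\beta_y(x)=x\,\overline{\ast}\,y$ (for every $y\in B$) are bijections of $B$, and the map $(x,y)\mapsto(y\,\overline{\ast}\,x,\;x\,\underline{\ast}\,y)$ is a bijection of $B\times B$; (3) for all $x,y,z\in B$: $(x\,\underline{\ast}\,y)\,\underline{\ast}\,(z\,\underline{\ast}\,y)=(x\,\underline{\ast}\,z)\,\underline{\ast}\,(y\,\overline{\ast}\,z)$, $(x\,\underline{\ast}\,y)\,\overline{\ast}\,(z\,\underline{\ast}\,y)=(x\,\overline{\ast}\,z)\,\underline{\ast}\,(y\,\overline{\ast}\,z)$, and $(x\,\overline{\ast}\,y)\,\overline{\ast}\,(z\,\overline{\ast}\,y)=(x\,\overline{\ast}\,z)\,\overline{\ast}\,(y\,\underline{\ast}\,z)$.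 $Aut(B)$ is the group of bijections of $B$ preserving both operations. The underlying quandle $\mathcal{Q}(B)$ is the set $B$ with operation $x*y=\beta_y^{-1}(x\,\underline{\ast}\,y)$. Every automorphism $f\in Aut(Q)$ of a quandle $Q=(X,* )$ defines a constant biquandle structure $\{\beta_y=f\mid y\in X\}$ on $Q$, which yields the biquandle $X_f=(X,\underline{\ast},\overline{\ast})$ with $x\,\underline{\ast}\,y=f(x*y)$ and $x\,\overline{\ast}\,y=f(x)$; its underlying quandle is $Q$. *)

(* Defs.v *)
From HB Require Import structures.
From mathcomp Require Import all_boot.
From mathcomp Require Import boolp.

Set Implicit Arguments.
Unset Strict Implicit.
Unset Printing Implicit Defensive.

Local Open Scope group_scope.

Record quandle := Quandle {
  qcarrier :> Type;
  qop : qcarrier -> qcarrier -> qcarrier;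
  qop_idem : forall x, qop x x = x;
  qop_bij : forall y, bijective (fun x => qop x y);
  qop_distr : forall x y z, qop (qop x y) z = qop (qop x z) (qop y z)
}.

(* bunder is the underlined star and bover the overlined one, so that         *)
(* alpha_y x = bunder x y and beta_y x = bover x y.                           *)
Record biquandle := Biquandle {
  bcarrier :> Type;
  bunder : bcarrier -> bcarrier -> bcarrier;
  bover : bcarrier -> bcarrier -> bcarrier;
  bdiag : forall x, bunder x x = bover x x;
  bunder_bij : forall y, bijective (fun x => bunder x y);
  bover_bij : forall y, bijective (fun x => bover x y);
  bswitch_bij : bijective (fun p : bcarrier * bcarrier =>
                             (bover p.2 p.1, bunder p.1 p.2));
  bexch_uu : forall x y z, bunder (bunder x y) (bunder z y) =
                           bunder (bunder x z) (bover y z);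
  bexch_uo : forall x y z, bover (bunder x y) (bunder z y) =
                           bunder (bover x z) (bover y z);
  bexch_oo : forall x y z, bover (bover x y) (bover z y) =
                           bover (bover x z) (bunder y z)
}.

Section InverseBijection.
Variables (T : Type) (f : T -> T).
Hypothesis f_bij : bijective f.

Lemma bij_inv_ex : exists g : T -> T, cancel f g /\ cancel g f.
Proof. by case: f_bij => g fK gK; exists g. Qed.

Definition bij_inv : T -> T := projT1 (cid bij_inv_ex).

Lemma bij_invK : cancel f bij_inv.
Proof. by rewrite /bij_inv; case: cid => g []. Qed.

Lemma bij_invKV : cancel bij_inv f.
Proof. by rewrite /bij_inv; case: cid => g []. Qed.

End InverseBijection.

Section UnderlyingQuandle.
Variable B : biquandle.

Definition underlying_op (x y : B) : B := bij_inv (@bover_bij B y) (bunder x y).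

Lemma bover_underlying_op x y : bover (underlying_op x y) y = bunder x y.
Proof. exact: (bij_invKV (@bover_bij B y)). Qed.

Lemma bover_inj y : injective (fun x : B => bover x y).
Proof. exact: bij_inj (@bover_bij B y). Qed.

Lemma underlying_op_idem x : underlying_op x x = x.
Proof. by apply: (@bover_inj x); rewrite bover_underlying_op bdiag. Qed.

Lemma underlying_op_bij y : bijective (fun x => underlying_op x y).
Proof.
apply: (@bij_comp _ _ _ (bij_inv (@bover_bij B y)) (fun x => bunder x y)).
  by exists (fun x => bover x y); [exact: bij_invKV | exact: bij_invK].
exact: bunder_bij.
Qed.

(* beta_(beta_y (z * y)) beta_y = beta_(beta_z y) beta_z *)
Lemma bover_bover x y z : bover (bover x y) (bover (underlying_op z y) y) =
                          bover (bover x z) (bover y z).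
Proof. by rewrite bover_underlying_op bexch_oo. Qed.

Lemma bover_morph z x y : bover (underlying_op x y) z =
                          underlying_op (bover x z) (bover y z).
Proof.
apply: (@bover_inj (bover y z)).
by rewrite bover_underlying_op -bexch_uo -bover_bover !bover_underlying_op.
Qed.

Lemma underlying_op_distr x y z : underlying_op (underlying_op x y) z =
  underlying_op (underlying_op x z) (underlying_op y z).
Proof.
apply: (@bover_inj z); apply: (@bover_inj (bover (underlying_op y z) z)).
rewrite bover_bover (bover_morph y) bover_underlying_op.
rewrite (bover_morph z (underlying_op x z)) bover_underlying_op.
by rewrite !bover_underlying_op bexch_uu.
Qed.

Definition underlying_quandle : quandle :=
  Quandle underlying_op_idem underlying_op_bij underlying_op_distr.

End UnderlyingQuandle.

(* All bijections T -> T; the group law below is (u * v) x = u (v x).         *)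
Record selfbij (T : Type) := SelfBij {
  selfbij_fun :> T -> T;
  selfbijP : bijective selfbij_fun
}.

Lemma selfbij_eqP T (u v : selfbij T) : u =1 v -> u = v.
Proof.
case: u v => [u ubij] [v vbij] /= /funext uv.
by case: v / uv vbij => vbij; rewrite (Prop_irrelevance ubij vbij).
Qed.

HB.instance Definition _ T := gen_eqMixin (selfbij T).
HB.instance Definition _ T := gen_choiceMixin (selfbij T).

Section SelfBijGroup.
Variable T : Type.
Implicit Types u v w : selfbij T.

Lemma id_selfbij_subproof : bijective (@id T).
Proof. by exists id. Qed.

Lemma inv_selfbij_subproof u : bijective (bij_inv (selfbijP u)).
Proof. by exists u; [exact: bij_invKV | exact: bij_invK]. Qed.

Definition selfbij_one := SelfBij id_selfbij_subproof.
Definition selfbij_mul u v := SelfBij (bij_comp (selfbijP u) (selfbijP v)).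
Definition selfbij_inv u := SelfBij (inv_selfbij_subproof u).

Lemma selfbij_mulA : associative selfbij_mul.
Proof. by move=> u v w; apply: selfbij_eqP. Qed.

Lemma selfbij_1mul : left_id selfbij_one selfbij_mul.
Proof. by move=> u; apply: selfbij_eqP. Qed.

Lemma selfbij_mul1 : right_id selfbij_one selfbij_mul.
Proof. by move=> u; apply: selfbij_eqP. Qed.

Lemma selfbij_Vmul : left_inverse selfbij_one selfbij_inv selfbij_mul.
Proof. by move=> u; apply: selfbij_eqP => x /=; rewrite bij_invK. Qed.

Lemma selfbij_mulV : right_inverse selfbij_one selfbij_inv selfbij_mul.
Proof. by move=> u; apply: selfbij_eqP => x /=; rewrite bij_invKV. Qed.

HB.instance Definition _ := isGroup.Build (selfbij T)
  selfbij_mulA selfbij_1mul selfbij_mul1 selfbij_Vmul selfbij_mulV.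

Lemma selfbij1E x : (1 : selfbij T) x = x.
Proof. by []. Qed.

Lemma selfbijME u v x : (u * v) x = u (v x).
Proof. by []. Qed.

Lemma selfbijVK u : cancel u u^-1.
Proof. exact: bij_invK. Qed.

Lemma selfbijKV u : cancel u^-1 u.
Proof. exact: bij_invKV. Qed.

Lemma selfbijV_morph (op : T -> T -> T) u :
  {morph u : x y / op x y} -> {morph u^-1 : x y / op x y}.
Proof.
move=> uM x y; apply: (bij_inj (selfbijP u)).
by rewrite uM !selfbijKV.
Qed.

End SelfBijGroup.

Section QuandleAut.
Variable Q : quandle.

Definition is_quandle_aut (f : selfbij Q) : bool :=
  `[< {morph f : x y / qop x y} >].

Record quandle_Aut := QuandleAut {
  quandle_Aut_val :> selfbij Q;
  quandle_AutP : is_quandle_aut quandle_Aut_val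
}.

HB.instance Definition _ := [isSub for quandle_Aut_val].
HB.instance Definition _ := [Choice of quandle_Aut by <:].

Lemma is_quandle_aut_closed : group_closed is_quandle_aut.
Proof.
split; first exact/asboolP.
move=> u v /asboolP uM /asboolP vM; apply/asboolP => x y.
by rewrite !selfbijME (selfbijV_morph vM) uM.
Qed.

HB.instance Definition _ :=
  SubChoice_isSubGroup.Build (selfbij Q) is_quandle_aut quandle_Aut
    is_quandle_aut_closed.

Lemma quandle_aut_morph (f : quandle_Aut) : {morph f : x y / qop x y}.
Proof. exact/asboolP/quandle_AutP. Qed.

End QuandleAut.

Section BiquandleAut.
Variable B : biquandle.

Definition is_biquandle_aut (f : selfbij B) : bool :=
  `[< {morph f : x y / bunder x y} /\ {morph f : x y / bover x y} >].

Record biquandle_Aut := BiquandleAut {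
  biquandle_Aut_val :> selfbij B;
  biquandle_AutP : is_biquandle_aut biquandle_Aut_val
}.

HB.instance Definition _ := [isSub for biquandle_Aut_val].
HB.instance Definition _ := [Choice of biquandle_Aut by <:].

Lemma is_biquandle_aut_closed : group_closed is_biquandle_aut.
Proof.
split; first exact/asboolP.
move=> u v /asboolP[uU uO] /asboolP[vU vO]; apply/asboolP.
split=> x y; rewrite !selfbijME.
  by rewrite (selfbijV_morph vU) uU.
by rewrite (selfbijV_morph vO) uO.
Qed.

HB.instance Definition _ :=
  SubChoice_isSubGroup.Build (selfbij B) is_biquandle_aut biquandle_Aut
    is_biquandle_aut_closed.

End BiquandleAut.

Section Centralizer.
Variables (G : groupType) (x : G).

Definition centralizes (y : G) : bool := y * x == x * y.

Record centralizer := Centralizer {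
  centralizer_val : G;
  centralizerP : centralizes centralizer_val
}.

HB.instance Definition _ := [isSub for centralizer_val].
HB.instance Definition _ := [Choice of centralizer by <:].

Lemma centralizes_closed : group_closed centralizes.
Proof.
split; first by rewrite unfold_in /centralizes mul1g mulg1.
move=> u v /eqP ux /eqP vx; apply/eqP.
by rewrite mulgA -ux -!mulgA; congr (_ * _); apply: (mulgI v);
  rewrite mulVKg mulgA vx mulgK.
Qed.

HB.instance Definition _ :=
  SubChoice_isSubGroup.Build G centralizes centralizer centralizes_closed.

End Centralizer.

(* A multiplicative map between groups preserves 1 and inverses.              *)
Definition isomorphic (G H : groupType) : Prop :=
  exists phi : {multiplicative G -> H}, bijective phi.

Section ConstantBiquandle.
Variables (Q : quandle) (f : quandle_Aut Q).

(* The biquandle X_f, given by the constant family beta_y = f.               *)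
Definition const_under (x y : Q) : Q := f (qop x y).
Definition const_over (x y : Q) : Q := f x.

Lemma quandle_aut_bij : bijective f.
Proof. exact: selfbijP. Qed.

Lemma const_diag x : const_under x x = const_over x x.
Proof. by rewrite /const_under qop_idem. Qed.

Lemma const_under_bij y : bijective (fun x => const_under x y).
Proof. exact: bij_comp quandle_aut_bij (@qop_bij Q y). Qed.

Lemma const_over_bij y : bijective (fun x => const_over x y).
Proof. exact: quandle_aut_bij. Qed.

Lemma const_switch_bij : bijective (fun p : Q * Q =>
  (const_over p.2 p.1, const_under p.1 p.2)).
Proof.
exists (fun q : Q * Q =>
  let y := bij_inv quandle_aut_bij q.1 in
  (bij_inv (@qop_bij Q y) (bij_inv quandle_aut_bij q.2), y)).
  by move=> [x y]; rewrite /const_over /const_under /= !bij_invK.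
move=> [a b]; rewrite /const_over /const_under /= bij_invKV.
by rewrite (bij_invKV (@qop_bij Q _)) bij_invKV.
Qed.

Lemma const_exch_uu x y z :
  const_under (const_under x y) (const_under z y) =
  const_under (const_under x z) (const_over y z).
Proof. by rewrite /const_under /const_over -!(quandle_aut_morph f) -qop_distr. Qed.

Lemma const_exch_uo x y z :
  const_over (const_under x y) (const_under z y) =
  const_under (const_over x z) (const_over y z).
Proof. by rewrite /const_under /const_over (quandle_aut_morph f). Qed.

Lemma const_exch_oo x y z :
  const_over (const_over x y) (const_over z y) =
  const_over (const_over x z) (const_under y z).
Proof. by []. Qed.

Definition const_biquandle : biquandle :=
  Biquandle const_diag const_under_bij const_over_bij const_switch_bij
    const_exch_uu const_exch_uo const_exch_oo.

Lemma underlying_const_biquandle : underlying_quandle const_biquandle = Q.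
Proof.
have opE : @underlying_op const_biquandle = @qop Q.
  apply/funext => x; apply/funext => y.
  apply: (@bover_inj const_biquandle y).
  by rewrite bover_underlying_op.
rewrite /underlying_quandle.
move: (@underlying_op_idem const_biquandle)
  (@underlying_op_bij const_biquandle) (@underlying_op_distr const_biquandle).
rewrite opE /=; case: Q => T op i b d /= i' b' d'.
by congr Quandle; exact: Prop_irrelevance.
Qed.

End ConstantBiquandle.

(* Main.v *)
(* Compatibility with the over operation x |-> f x is exactly commutation with  *)
(* f; given that, the injective f cancels from compatibility with f (x * y).    *)

Require Import Defs.
From HB Require Import structures.
From mathcomp Require Import all_boot.
From mathcomp Require Import boolp.

Local Open Scope group_scope.

(** Both groups consist of the same bijections of [Q] under composition: those preserving [qop] and
    commuting with [f]. This is [is_biquandle_aut_constP]; the isomorphism leaves the underlying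
    bijection unchanged and only swaps the membership proofs. *)

Section ConstantBiquandleAut.
Variables (Q : quandle) (f : quandle_Aut Q).

Lemma is_biquandle_aut_constP (u : selfbij Q) :
  reflect ({morph u : x y / qop x y} /\ (forall x, u (f x) = f (u x)))
          (@is_biquandle_aut (const_biquandle f) u).
Proof.
apply: (iffP (asboolP _)) => [[uU uO] | [uM uf]].
  (* [const_over] ignores its second argument, so any value would do there. *)
  have uf x : u (f x) = f (u x) by exact: (uO x x).
  split=> // x y; apply: (bij_inj (selfbijP f)).
  by rewrite -uf; exact: uU.
split=> x y; last exact: uf.
by rewrite /= /const_under uf uM.
Qed.

(** Type-checks because the carrier of [const_biquandle f] is convertible to that of [Q]. *)
Lemma biquandle_aut_quandle_aut (g : biquandle_Aut (const_biquandle f)) :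
  @is_quandle_aut Q (biquandle_Aut_val g).
Proof.
by apply/asboolP; case/is_biquandle_aut_constP: (biquandle_AutP g).
Qed.

Definition quandle_aut_of_biquandle_aut g : quandle_Aut Q :=
  QuandleAut (biquandle_aut_quandle_aut g).

Lemma quandle_aut_of_biquandle_aut_centralizes g :
  centralizes f (quandle_aut_of_biquandle_aut g).
Proof.
apply/eqP/val_inj/selfbij_eqP => x.
by case/is_biquandle_aut_constP: (biquandle_AutP g) => _; exact.
Qed.

Definition centralizer_of_biquandle_aut g : centralizer f :=
  Centralizer (quandle_aut_of_biquandle_aut_centralizes g).

Lemma centralizer_biquandle_aut (h : centralizer f) :
  @is_biquandle_aut (const_biquandle f) (val (val h)).
Proof.
apply/is_biquandle_aut_constP; split; first exact: quandle_aut_morph.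
move=> x; have /eqP/(congr1 val) hf := centralizerP h.
exact: (congr1 (fun u : selfbij Q => u x) hf).
Qed.

Definition biquandle_aut_of_centralizer h :
    biquandle_Aut (const_biquandle f) :=
  BiquandleAut (centralizer_biquandle_aut h).

Lemma centralizer_of_biquandle_autK :
  cancel centralizer_of_biquandle_aut biquandle_aut_of_centralizer.
Proof. by move=> g; exact: val_inj. Qed.

Lemma biquandle_aut_of_centralizerK :
  cancel biquandle_aut_of_centralizer centralizer_of_biquandle_aut.
(* Two layers to strip: [centralizer] over [quandle_Aut], then [quandle_Aut] over [selfbij]. *)
Proof. by move=> h; do 2 apply: val_inj. Qed.

Lemma centralizer_of_biquandle_autM :
  {morph centralizer_of_biquandle_aut : g h / g * h}.
Proof. by move=> g h; do 2 apply: val_inj. Qed.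

(** Lets the map serve as the [{multiplicative G -> H}] witness in [isomorphic]. *)
HB.instance Definition _ := isMultiplicative.Build _ _
  centralizer_of_biquandle_aut centralizer_of_biquandle_autM.

End ConstantBiquandleAut.

Theorem corollary3p2 (Q : quandle) (f : quandle_Aut Q) :
  isomorphic (biquandle_Aut (const_biquandle f)) (centralizer f).
Proof.
exists (centralizer_of_biquandle_aut Q f).
exists (biquandle_aut_of_centralizer Q f).
  exact: centralizer_of_biquandle_autK.
exact: biquandle_aut_of_centralizerK.
Qed.
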